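(* Let $p$ be an odd prime, let $r=\frac{a}{b}\in\mathbb{Q}$ with $r\neq 0$, and put $k_0=-v_p(r)$. Write $r=\frac{\alpha}{\beta p^{k_0}}$ with $\alpha\in\mathbb{Z}$, $\beta\in\mathbb{N}^*$, $\gcd(\alpha,p)=\gcd(\beta,p)=1$, and let $\beta_n, k_n, x_n, r_n, a_n$ be the quantities produced from $r$ by Browkin's $p$-adic continued fraction algorithm (described in the context), with $\beta_{-1}=\alpha$, $\beta_0=\beta$. Then the set $$\left\{ n\in\mathbb{N} : a_n=\langle r_n\rangle_p=\frac{x_n}{p^{k_n}}\right\}$$ of indices $n$ for which the algorithm produces a partial quotient $a_n$ is finite, and its cardinality is at most the integer part of the real number $$\frac{-1}{\log\lambda_1}\,\log\left(\frac{2|\beta_1|}{\lambda_1-\lambda_2}+|\beta_0|\right),$$ where $\lambda_1=\frac{p+\sqrt{p^2+16}}{4p}$ and $\lambda_2=\frac{p-\sqrt{p^2+16}}{4p}$ are the roots of the equation $2p^2X^2-p^2X-2=0$.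
   Context: $p$ is an odd prime, $v_p$ is the $p$-adic valuation, $|\cdot|$ is the ordinary absolute value, $\mathbb{N}=\{0,1,2,\dots\}$, $\mathbb{N}^*=\mathbb{N}\setminus\{0\}$. Fractional part. Every $x\in\mathbb{Q}_p$ has a unique expansion $x=\sum_{n\ge -j}\alpha'_n p^n$ with digits $\alpha'_n\in\{-\frac{p-1}{2},\dots,-1,0,1,\dots,\frac{p-1}{2}\}$. Its fractional part is $\langle x\rangle_p=\sum_{-j\le n\le 0}\alpha'_n p^n$ (an empty sum is $0$); it is an element of $\mathbb{Z}[1/p]\cap(-\frac p2,\frac p2)$. Browkin's algorithm for a nonzero rational $r$. Put $k_0=-v_p(r)$ and write $r=\frac{\alpha}{\beta p^{k_0}}$ with $\alpha\in\mathbb{Z}$, $\beta\in\mathbb{N}^*$ both prime to $p$. Set $\beta_{-1}=\alpha$, $\beta_0=\beta$, $r_0=r$, $a_0=\langle r\rangle_p$ and $x_0=p^{k_0}a_0$. For $n\ge 1$, as long as $\beta_{n-1}\neq 0$ and $\beta_{n-2}-x_{n-1}\beta_{n-1}\ne 0$, define $$k_n=v_p\!\left(\frac{\beta_{n-2}-x_{n-1}\beta_{n-1}}{p^{k_{n-1}}}\right)\in\mathbb{N}^*,\qquad \beta_n=\frac{\beta_{n-2}-x_{n-1}\beta_{n-1}}{p^{k_{n-1}}p^{k_n}},\qquad r_n=\frac{1}{r_{n-1}-a_{n-1}}=\frac{\beta_{n-1}}{\beta_n p^{k_n}},$$ let $x_n$ be the integer with $x_n\equiv\beta_{n-1}\beta_n^{-1}\pmod{p^{1+k_n}}$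 and $|x_n|<\frac{p^{1+k_n}}{2}$, and put $a_n=\langle r_n\rangle_p=\frac{x_n}{p^{k_n}}$. If $\beta_{n-2}-x_{n-1}\beta_{n-1}=0$ (equivalently $r_{n-1}=a_{n-1}$), the algorithm stops: $a_{n-1}$ is the last partial quotient, and one sets $\beta_m=0$ for all $m\ge n$. The resulting expansion is $r=a_0+\cfrac{1}{a_1+\cfrac{1}{a_2+\cdots}}$.
   Formalization: The cardinality bound (not finiteness) is proved except when β=1 and r=⟨r⟩_p, where it is false: the algorithm then stops after a_0, so β_1=0, β_0=1, and the bound is 0 while the set {0} has one element (e.g. p=3, r=1). *)

(* Defs.v *)
From HB Require Import structures.
From mathcomp Require Import all_boot all_order all_algebra.
From mathcomp Require Import all_classical all_reals all_analysis.
Set Implicit Arguments.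
Unset Strict Implicit.
Unset Printing Implicit Defensive.
Import Order.TTheory GRing.Theory Num.Theory.
Local Open Scope classical_set_scope.
Local Open Scope ring_scope.

(* Everything the algorithm manipulates is rational, so the p-adic notions are
   only needed on [rat], regarded as a subset of Q_p. *)

(* Junk value: [vp p 0 = 0]; the predicates below treat 0 separately. *)
Definition vp (p : nat) (x : rat) : int :=
  (logn p `|numq x|)%:Z - (logn p `|denq x|)%:Z.

(* p ^ m divides x in the localization of Z at p. *)
Definition vp_ge (p : nat) (m : int) (x : rat) : Prop := x = 0 \/ m <= vp p x.

Definition digit (p : nat) (c : int) : Prop := (`|c| <= p.-1./2)%N.

(* \sum_(- j <= n < m) d n * p ^ n, with n = i - j *)
Definition digit_sum (p j : nat) (d : int -> int) (m : nat) : rat :=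
  \sum_(0 <= i < j + m) (d (i%:Z - j%:Z))%:~R * p%:R ^ (i%:Z - j%:Z).

(* x = \sum_(n >= - j) d n * p ^ n, the series converging p-adically. *)
Definition padic_expansion (p : nat) (x : rat) (j : nat) (d : int -> int) : Prop :=
  (forall n : int, digit p (d n)) /\
  (forall N : int, exists M : nat, forall m : nat, (M <= m)%N ->
     vp_ge p N (x - digit_sum p j d m)).

(* Taking [m := 1] in [digit_sum] keeps the digits of index n <= 0. *)
Definition fracpart (p : nat) (x : rat) : rat :=
  xget 0 [set y : rat | exists j : nat, exists d : int -> int,
    padic_expansion p x j d /\ y = digit_sum p j d 1].

(* The integer x with x = y (mod p ^ (1 + k)) and |x| < p ^ (1 + k) / 2, for a
   rational y without p in its denominator and k >= 0. *)
Definition balanced_residue (p : nat) (k : int) (y : rat) : int :=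
  xget 0 [set x : int | vp_ge p (1 + k) (x%:~R - y) /\
                        `|x%:~R : rat| < p%:R ^ (1 + k) / 2].

(* The data at index n: beta_(n-1), beta_n, k_n, x_n, r_n, a_n.
   The beta_n and x_n are typed as rationals because they are defined by
   divisions (and x_0 = p ^ k_0 * a_0 with k_0 possibly negative). *)
Record bstate := BState {
  bs_betap : rat; bs_beta : rat; bs_k : int; bs_x : rat; bs_r : rat; bs_a : rat }.

Definition browkin_init (p : nat) (r : rat) (alpha : int) (beta : nat) : bstate :=
  let k0 := - vp p r in
  let a0 := fracpart p r in
  BState alpha%:~R beta%:R k0 (p%:R ^ k0 * a0) r a0.

Definition browkin_step (p : nat) (s : bstate) : option bstate :=
  let num := bs_betap s - bs_x s * bs_beta s in
  if (bs_beta s == 0) || (num == 0) then None else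
  let k := vp p (num / p%:R ^ bs_k s) in
  let beta := num / (p%:R ^ bs_k s * p%:R ^ k) in
  let r := (bs_r s - bs_a s)^-1 in
  let x := balanced_residue p k (bs_beta s / beta) in
  Some (BState (bs_beta s) beta k x%:~R r (fracpart p r)).

(* [None] once the algorithm has stopped. *)
Definition browkin (p : nat) (r : rat) (alpha : int) (beta : nat) (n : nat) :
    option bstate :=
  iter n (obind (browkin_step p)) (Some (browkin_init p r alpha beta)).

Definition browkin_beta (p : nat) (r : rat) (alpha : int) (beta n : nat) : rat :=
  if browkin p r alpha beta n is Some s then bs_beta s else 0.

Definition browkin_indices (p : nat) (r : rat) (alpha : int) (beta : nat) : set nat :=
  [set n | exists s : bstate, [/\ browkin p r alpha beta n = Some s,
     bs_a s = fracpart p (bs_r s) & bs_a s = bs_x s / p%:R ^ bs_k s]].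

Definition lambda1 (R : realType) (p : nat) : R :=
  (p%:R + Num.sqrt (p%:R ^+ 2 + 16)) / (4 * p%:R).
Definition lambda2 (R : realType) (p : nat) : R :=
  (p%:R - Num.sqrt (p%:R ^+ 2 + 16)) / (4 * p%:R).

Definition browkin_bound (R : realType) (p : nat) (r : rat) (alpha : int)
    (beta : nat) : R :=
  -1 / ln (lambda1 R p) *
  ln (2 * `|ratr (browkin_beta p r alpha beta 1)| / (lambda1 R p - lambda2 R p)
      + `|ratr (browkin_beta p r alpha beta 0)|).

(* If beta = 1 and r = <r>_p (for instance r = 1), the algorithm produces exactly
   one partial quotient, a_0, while beta_0 = 1 and beta_1 = 0, so that
   [browkin_bound] is a multiple of ln 1 = 0: the inequality "cardinality <=
   integer part of the bound" reads 1 <= 0.  *)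
Definition browkin_degenerate (p : nat) (r : rat) (beta : nat) : Prop :=
  beta = 1%N /\ fracpart p r = r.

(* Main.v *)
(* Let N be the number of partial quotients.  For 1 <= n < N, beta_n is a nonzero
   integer, and since |x_(n-1)| < p^(1+k_(n-1)) / 2 and k_n >= 1,
     |beta_n| <= |beta_(n-1)| / 2 + |beta_(n-2)| / p^2     (2 <= n < N).
   As lambda_1^2 = lambda_1 / 2 + 1 / p^2, the sequence lambda_1^(n+1) * C with
   C = 2 |beta_1| / (lambda_1 - lambda_2) + |beta_0| satisfies the corresponding
   equality, and it dominates |beta_n| for n = 1 and n = 2, hence for all n >= 1
   (but not always for n = 0).  Thus 1 <= |beta_(N-1)| <= lambda_1^N * C when
   N >= 2, and taking logarithms bounds N.  When N = 1 we have beta_1 = 0, so the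
   bound requires lambda_1 * beta_0 >= 1, which fails only if beta_0 = 1. *)
Require Import Defs.
From mathcomp Require Import all_boot all_order all_algebra finmap.
From mathcomp Require Import all_classical all_reals all_analysis.
From mathcomp Require Import ring lra zify.
Import Order.TTheory GRing.Theory Num.Theory.
Local Open Scope fset_scope.
Local Open Scope ring_scope.

Set Implicit Arguments.
Unset Strict Implicit.

(** * The p-adic valuation on the rationals *)

(** Cross-multiplying with the reduced fraction of [x] gives an identity of integers, on which
    [logn] is additive; so any fraction representing [x] may be used. *)
Lemma vp_frac (p : nat) (x : rat) (u v : int) : u != 0 -> v != 0 ->
  x * v%:~R = u%:~R -> vp p x = (logn p `|u|)%:Z - (logn p `|v|)%:Z.
Proof.
move=> u0 v0 xvu.
have x0 : x != 0.
  apply: contraNneq u0 => x0; move: xvu; rewrite x0 mul0r => /esym/eqP.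
  by rewrite intr_eq0.
have : numq x * v = u * denq x.
  apply/eqP; rewrite -(eqr_int rat) !intrM -xvu mulrAC; apply/eqP; congr (_ * _).
  by rewrite -[X in X * _]divq_num_den divfK ?intr_eq0 ?denq_neq0// numqE.
move=> /(congr1 absz); rewrite !abszM => /(congr1 (logn p)).
rewrite !lognM ?absz_gt0 ?numq_eq0 ?denq_neq0// /vp; lia.
Qed.

Section PadicValuation.
Variables (p : nat) (p_pr : prime p).

Let pR0 : p%:R != 0 :> rat.
Proof. by rewrite pnatr_eq0 -lt0n prime_gt0. Qed.

Let pZ0 (k : int) : p%:R ^ k != 0 :> rat.
Proof. exact: expfz_neq0. Qed.

Let lognX_prime k : logn p (p ^ k) = k.
Proof. by rewrite lognX logn_prime// eqxx muln1. Qed.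

Let pX0 k : p%:Z ^+ k != 0.
Proof. by rewrite expf_neq0 // eqz_nat -lt0n prime_gt0. Qed.

Lemma vp_fracX (x : rat) (u v m : int) : u != 0 -> v != 0 ->
  x * v%:~R = u%:~R * p%:R ^ m ->
  vp p x = (logn p `|u|)%:Z - (logn p `|v|)%:Z + m.
Proof.
move=> u0 v0; case: m => k E.
  rewrite (@vp_frac p x (u * p%:Z ^+ k) v) ?mulf_neq0//.
    by rewrite abszM abszX lognM ?absz_gt0 ?expn_gt0 ?prime_gt0//= lognX_prime; lia.
  by rewrite E intrM rmorphXn.
rewrite (@vp_frac p x u (v * p%:Z ^+ k.+1)) ?mulf_neq0//.
  by rewrite abszM abszX lognM ?absz_gt0 ?expn_gt0 ?prime_gt0//= lognX_prime; lia.
rewrite intrM mulrA E rmorphXn /= NegzE -exprnN -pmulrn divfK //.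
by rewrite expf_neq0.
Qed.

Let pN1 : ~~ (p %| 1)%N.
Proof. by rewrite dvdn1; apply: contraL p_pr => /eqP ->. Qed.

Let ndvd_neq0 (v : int) : ~~ (p %| `|v|)%N -> v != 0.
Proof. by apply: contraNneq => ->; rewrite dvdn0. Qed.

Let ndvd_logn (v : int) : ~~ (p %| `|v|)%N -> logn p `|v| = 0%N.
Proof. by move=> pv; rewrite logn_coprime// prime_coprime. Qed.

(** Working form of [vp_ge]: zero is covered by [u = 0], and closure under sums and products becomes
    arithmetic of fractions whose denominators stay prime to [p] by Euclid's lemma. *)
Lemma vp_geP (m : int) (x : rat) : vp_ge p m x <->
  exists u v : int, ~~ (p %| `|v|)%N /\ x * v%:~R = u%:~R * p%:R ^ m.
Proof.
split.
- have [-> _|x0] := eqVneq x 0; first by exists 0, 1; rewrite !mul0r.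
  case=> [/eqP|]; first by rewrite (negbTE x0).
  have n0 : (0 < `|numq x|)%N by rewrite absz_gt0 numq_eq0.
  have d0 : (0 < `|denq x|)%N by rewrite absz_gt0 denq_neq0.
  have [n' pn En] := pfactor_coprime p_pr n0.
  have [d' pd Ed] := pfactor_coprime p_pr d0.
  rewrite /vp; set e := logn p _ in En *; set f := logn p _ in Ed * => mle.
  (* [n'] and [d'] are the prime-to-[p] parts of numerator and denominator; the leftover exponent
     [e - f - m] is nonnegative by [mle]. *)
  exists (Num.sg (numq x) * n'%:Z * p%:Z ^+ `|(e%:Z - f%:Z - m)%R|%N), d'; split.
    by rewrite -prime_coprime.
  have En' : (numq x)%:~R = (Num.sg (numq x) * n')%:~R * p%:R ^ e%:Z :> rat.
    rewrite {1}[numq x]numEsg -abszE En PoszM -exprnP !intrM -mulrA; congr (_ * _).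
    by rewrite -!pmulrn natrX.
  have Ed' : (denq x)%:~R = d'%:R * p%:R ^ f%:Z :> rat.
    by rewrite -absz_denq Ed -pmulrn natrM natrX.
  rewrite -[X in X * _]divq_num_den Ed' En' [in RHS]intrM rmorphXn /= -!pmulrn.
  rewrite exprnP gez0_abs; last by lia.
  rewrite -[in RHS]mulrA -expfzDr// subrK expfzDr// -invr_expz.
  have : d'%:R != 0 :> rat.
    by rewrite pnatr_eq0; apply: contraTneq pd => ->; rewrite prime_coprime// dvdn0.
  have := pZ0 f; move: (_ ^ Posz f) (_ ^ Posz e) => F E F0 d'0.
  by field; rewrite F0 d'0.
- case=> u [v [pv xv]].
  have [->|x0] := eqVneq x 0; [by left | right].
  have v0 := ndvd_neq0 pv.
  have u0 : u != 0.
    apply: contraNneq x0 => u0; move/eqP: xv; rewrite u0 mul0r mulf_eq0 intr_eq0.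
    by rewrite (negbTE v0) orbF.
  by rewrite (@vp_fracX x u v m)// (ndvd_logn pv); lia.
Qed.

Lemma vp_geM m n x y : vp_ge p m x -> vp_ge p n y -> vp_ge p (m + n) (x * y).
Proof.
move=> /vp_geP[u [v [pv xv]]] /vp_geP[u' [v' [pv' yv]]].
apply/vp_geP; exists (u * u'), (v * v'); split.
  by rewrite abszM Euclid_dvdM// negb_or pv.
by rewrite !intrM mulrACA xv yv expfzDr// mulrACA.
Qed.

Lemma vp_geD m x y : vp_ge p m x -> vp_ge p m y -> vp_ge p m (x + y).
Proof.
move=> /vp_geP[u [v [pv xv]]] /vp_geP[u' [v' [pv' yv]]].
apply/vp_geP; exists (u * v' + u' * v), (v * v'); split.
  by rewrite abszM Euclid_dvdM// negb_or pv.
rewrite intrD !intrM mulrDl mulrA xv [v%:~R * _]mulrC mulrA yv; ring.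
Qed.

Lemma vp_geW m n x : m <= n -> vp_ge p n x -> vp_ge p m x.
Proof. by move=> mn [->|nx]; [left | right; apply: le_trans nx]. Qed.

Lemma vp_geX (m : int) : vp_ge p m (p%:R ^ m).
Proof. by apply/vp_geP; exists 1, 1; rewrite mulr1 mul1r. Qed.

Lemma vp_ge_int (u : int) : vp_ge p 0 u%:~R.
Proof. by apply/vp_geP; exists u, 1; rewrite !mulr1. Qed.

Lemma vp_geN m x : vp_ge p m x -> vp_ge p m (- x).
Proof. by move=> /(vp_geM (vp_ge_int (-1))); rewrite add0r mulN1r. Qed.

Lemma vp_geB m x y : vp_ge p m x -> vp_ge p m y -> vp_ge p m (x - y).
Proof. by move=> ? /vp_geN; exact: vp_geD. Qed.

Lemma vp_ge_sum m (I : Type) (s : seq I) (P : pred I) (F : I -> rat) :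
  (forall i, P i -> vp_ge p m (F i)) -> vp_ge p m (\sum_(i <- s | P i) F i).
Proof. by move=> PF; apply: big_ind => //; [left | move=> *; exact: vp_geD]. Qed.

Lemma vp_ge_frac (u v : int) : ~~ (p %| `|v|)%N -> vp_ge p 0 (u%:~R / v%:~R).
Proof.
by move=> pv; apply/vp_geP; exists u, v; rewrite mulr1 divfK// intr_eq0 ndvd_neq0.
Qed.

(* Z[1/p] and the localization of Z at p meet in Z. *)
Lemma vp_ge0_int (j : nat) (c : int) (x : rat) :
  vp_ge p 0 x -> x * p%:R ^+ j = c%:~R -> exists z : int, x = z%:~R.
Proof.
move=> /vp_geP[u [v [pv]]]; rewrite mulr1 => xv xc.
have E : c * v = u * p%:Z ^+ j.
  by apply/eqP; rewrite -(eqr_int rat) !intrM -xc -xv rmorphXn/=; apply/eqP; ring.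
have : (p ^ j %| `|c|)%N.
  rewrite -(@Gauss_dvdl _ _ `|v|) ?coprimeXl ?prime_coprime//.
  by rewrite -abszM E abszM abszX dvdn_mull.
move=> /dvdnP[q cq].
exists (Num.sg c * q%:Z).
apply: (mulIf (expf_neq0 j pR0)); rewrite xc {1}[c]numEsg -abszE cq PoszM !intrM -mulrA.
by rewrite -!pmulrn natrX.
Qed.

End PadicValuation.

(** * Balanced residues *)

(** Shifting by [q./2] before Euclidean division and back afterwards centres the remainder at 0; as
    [q] is odd, the interval is symmetric. *)
Lemma balanced_remainder (q : nat) (t : int) : odd q ->
  exists x : int, (`|x| * 2 < q)%N /\ (q%:Z %| x - t)%Z.
Proof.
move=> oq; have q0 : q%:Z != 0 by case: q oq.
exists (((t + (q./2)%:Z) %% q%:Z)%Z - (q./2)%:Z); split.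
  have := modz_ge0 (t + (q./2)%:Z) q0; have := ltz_mod (t + (q./2)%:Z) q0.
  have := odd_double_half q; rewrite oq; lia.
apply/dvdzP; exists (- ((t + (q./2)%:Z) %/ q%:Z)%Z).
have := divz_eq (t + (q./2)%:Z) q%:Z; lia.
Qed.

Lemma balanced_residueP (p : nat) (k : nat) (y : rat) : prime p -> odd p ->
  vp_ge p 0 y ->
  vp_ge p k.+1%:Z ((balanced_residue p k%:Z y)%:~R - y) /\
  (`|balanced_residue p k%:Z y| * 2 < p ^ k.+1)%N.
Proof.
move=> p_pr p_odd /(vp_geP p_pr)[u [v [pv]]]; rewrite mulr1 => yv.
have cop : gcdz v (p ^ k.+1)%N%:Z = 1.
  apply/eqP; rewrite -[_ == _]/(coprimez _ _) coprimezE /= coprimeXr//.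
  by rewrite coprime_sym prime_coprime.
have [w1 [w2]] := Bezoutz v (p ^ k.+1)%N; rewrite cop => bez.
have oq : odd (p ^ k.+1) by rewrite oddX p_odd orbT.
have [x [xlt /dvdzP[c xc]]] := balanced_remainder (u * w1) oq.
have ltE (z : int) :
    (`|z%:~R : rat| < p%:R ^ (1 + k%:Z) / 2) = (`|z| * 2 < p ^ k.+1)%N.
  rewrite ltr_pdivlMr// -intr_norm -[2]/(2%:~R) -intrM -[1 + _]/(Posz k.+1) -exprnP.
  by rewrite -natrX [ltRHS]pmulrn ltr_int -abszE -PoszM ltz_nat.
have [] : [set x : int | vp_ge p (1 + k%:Z) (x%:~R - y) /\
    `|x%:~R : rat| < p%:R ^ (1 + k%:Z) / 2]%classic (balanced_residue p k%:Z y).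
  apply: (@xgetI _ _ _ x); split; last by rewrite ltE.
  (* By Bezout, [w1] inverts [v] modulo [p ^ k.+1], so [x] was chosen congruent to [u * w1]. The
     witness comes from expanding [x * v - u] with [w1 * v + w2 * p ^ k.+1 = 1]. *)
  apply/(vp_geP p_pr); exists (c * v - w2 * u), v; split => //.
  rewrite mulrBl yv -[1 + _]/(Posz k.+1) -exprnP -natrX pmulrn -!intrM -intrB.
  congr (_%:~R); rewrite -[x](subrK (u * w1)) xc.
  have -> : (c * (p ^ k.+1)%N + u * w1) * v - u
    = c * (p ^ k.+1)%N * v + u * (w1 * v - 1) by ring.
  by rewrite -bez; ring.
by rewrite ltE.
Qed.

(** * Digit expansions and the fractional part *)

Lemma digit_sumX (p j m : nat) (d : int -> int) : (0 < p)%N ->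
  digit_sum p j d m * p%:R ^+ j =
  (\sum_(0 <= i < j + m) d (i%:Z - j%:Z) * p%:Z ^+ i)%:~R.
Proof.
move=> p_gt0; have p0 : p%:R != 0 :> rat by rewrite pnatr_eq0 -lt0n.
rewrite /digit_sum mulr_suml rmorph_sum /=; apply: eq_bigr => i _.
by rewrite -mulrA exprnP -expfzDr// subrK intrM rmorphXn.
Qed.

(** Induction on [n]: twice the new top term is at most [(p - 1) * p ^ n], and
    [(p - 1) * p ^ n + p ^ n = p ^ n.+1]. *)
Lemma digits_lt (p n : nat) (c : nat -> int) : odd p -> (forall i, digit p (c i)) ->
  (`|(\sum_(0 <= i < n) c i * p%:Z ^+ i)%R| * 2 < p ^ n)%N.
Proof.
move=> p_odd cd; elim: n => [|n IH]; first by rewrite big_nil.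
rewrite big_nat_recr //=.
have /= := cd n; rewrite /digit => cn.
have c2 : (`|c n| * 2 <= p.-1)%N by have := odd_double_half p.-1; lia.
have : (`|(c n * p%:Z ^+ n)%R| * 2 <= p.-1 * p ^ n)%N.
  by rewrite abszM abszX /= mulnAC leq_mul2r c2 orbT.
have -> : (p ^ n.+1 = p.-1 * p ^ n + p ^ n)%N.
  by rewrite -[X in (X ^ _)%N](prednK (odd_gt0 p_odd)) expnS mulSn addnC prednK ?odd_gt0.
move: IH; set S : int := \sum_(0 <= i < n) _; set T : int := c n * _.
lia.
Qed.

(** Greedy construction: scale [r] to be p-integral, then repeatedly subtract the balanced residue
    modulo [p] and divide by [p]. It guarantees that the [xget] in [fracpart] picks a genuine
    value. *)
Lemma padic_expansion_exists (p : nat) (r : rat) : prime p -> odd p ->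
  exists j d, padic_expansion p r j d.
Proof.
move=> p_pr p_odd; have p0 : p%:R != 0 :> rat by rewrite pnatr_eq0 -lt0n prime_gt0.
have [j rj] : exists j : nat, vp_ge p 0 (r * p%:R ^+ j).
  exists `|vp p r|%N; rewrite -(subrr `|vp p r|%N%:Z) addrC.
  apply: vp_geM => //; last exact: vp_geX.
  by right; lia.
pose y i := iter i (fun y => (y - (balanced_residue p 0 y)%:~R) / p%:R) (r * p%:R ^+ j).
have y0 i : vp_ge p 0 (y i).
  elim: i => //= i IH.
  have [/(vp_geN p_pr)] := balanced_residueP 0 p_pr p_odd IH.
  rewrite opprB => yi _; rewrite -(subrr 1%:Z); apply: vp_geM => //.
  exact: (vp_geX p_pr (-1)).
pose e i := balanced_residue p 0 (y i).
(* After [n] digits the remainder is [y n * p ^ n] with [y n] p-integral, which gives the p-adic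
   convergence. *)
have rE n : r * p%:R ^+ j = (\sum_(0 <= i < n) e i * p%:Z ^+ i)%:~R + y n * p%:R ^+ n.
  elim: n => [|n IH]; first by rewrite big_nil add0r mulr1.
  rewrite IH big_nat_recr//= intrD -addrA; congr (_ + _).
  by rewrite intrM rmorphXn /= -/(e n) exprS; field; rewrite p0.
pose d n := if n + j%:Z is Posz i then e i else 0.
have dE i : d (i%:Z - j%:Z) = e i by rewrite /d subrK.
exists j, d; split=> [n|N].
  rewrite /d; case: (n + _) => // i.
  have [_] := balanced_residueP 0 p_pr p_odd (y0 i).
  rewrite /digit -/(e i); have := odd_double_half p; rewrite p_odd expn1; lia.
exists `|N|%N => m Nm; apply: (@vp_geW p _ m%:Z); first by lia.
have -> : r - digit_sum p j d m = y (j + m)%N * p%:R ^ m%:Z.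
  apply: (mulIf (expf_neq0 j p0)); rewrite mulrBl digit_sumX ?prime_gt0//.
  rewrite (eq_bigr (fun i => e i * p%:Z ^+ i)) => [|i _]; last by rewrite dE.
  by rewrite (rE (j + m)%N) addrC addKr exprD -mulrA -exprnP [p%:R ^+ m * _]mulrC.
rewrite -[m%:Z]add0r; apply: vp_geM => //.
exact: vp_geX.
Qed.

(** Both facts hold for whichever expansion [xget] picks: the discarded tail has only positive
    powers of [p], and the retained head has [j + 1] balanced digits once multiplied by [p ^ j]. *)
Lemma fracpartP (p : nat) (r : rat) : prime p -> odd p ->
  vp_ge p 1 (r - fracpart p r) /\
  exists (j : nat) (c : int), fracpart p r * p%:R ^+ j = c%:~R /\
    (`|c| * 2 < p ^ j.+1)%N.
Proof.
move=> p_pr p_odd.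
have [j [d [[dd dlim] ->]]] : [set y : rat | exists j : nat, exists d : int -> int,
    padic_expansion p r j d /\ y = digit_sum p j d 1]%classic (fracpart p r).
  apply: xgetPex; have [j [d rd]] := padic_expansion_exists r p_pr p_odd.
  by exists (digit_sum p j d 1), j, d.
split; last first.
  exists j, (\sum_(0 <= i < j + 1) d (i%:Z - j%:Z) * p%:Z ^+ i); split.
    by rewrite digit_sumX// prime_gt0.
  by rewrite -[j.+1]addn1; exact: (@digits_lt p (j + 1) (fun i => d (i%:Z - j%:Z))).
have [M /(_ (M + 1)%N (leq_addr _ _)) rM] := dlim 1.
rewrite -[r](subrK (digit_sum p j d (M + 1))) -addrA.
apply: vp_geD => //.
(* The terms from [i = j + 1] on carry the exponent [i - j >= 1]. *)
rewrite /digit_sum (@big_cat_nat _ _ _ (j + 1)) ?leq_add2l ?leq_addl//=.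
rewrite addrC addKr big_nat_cond; apply: vp_ge_sum => // i /andP[/andP[ji _] _].
apply: (@vp_geW p _ (0 + (i%:Z - j%:Z))); first by lia.
apply: vp_geM => //; [exact: vp_ge_int | exact: vp_geX].
Qed.

(* [fracpart p r] vanishes when the valuation of [r] is positive; otherwise its
   denominator divides [p ^ (- vp p r)]. *)
Lemma scaled_fracpart_int (p : nat) (r : rat) : prime p -> odd p ->
  exists z : int, p%:R ^ (- vp p r) * fracpart p r = z%:~R.
Proof.
move=> p_pr p_odd; have p0 : p%:R != 0 :> rat by rewrite pnatr_eq0 -lt0n prime_gt0.
have [ra [j [c [ac clt]]]] := fracpartP r p_pr p_odd.
have rv : vp_ge p (vp p r) r by right.
have rv0 : vp_ge p 0 (p%:R ^ (- vp p r) * r).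
  by rewrite -(addNr (vp p r)); apply: vp_geM => //; exact: vp_geX.
have aE : fracpart p r = r - (r - fracpart p r) by rewrite subKr.
case: (leP (vp p r) 0) => v0.
- have [k kE] : exists k : nat, - vp p r = k by exists `|vp p r|%N; lia.
  apply: (@vp_ge0_int _ p_pr j (c * p%:Z ^+ k)).
    rewrite aE mulrBr; apply: vp_geB => //.
    apply: (@vp_geW p _ (- vp p r + 1)); first by lia.
    by apply: vp_geM => //; exact: vp_geX.
  by rewrite -mulrA ac kE intrM rmorphXn mulrC.
(* Here [fracpart p r / p] is p-integral and lies in Z[1/p], hence is an integer [z]; then
   [c = z * p ^ j.+1], and the size bound on [c] forces [z = 0]. *)
- suff -> : fracpart p r = 0 by exists 0; rewrite mulr0.
  have a1 : vp_ge p 1 (fracpart p r).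
    by rewrite aE; apply: vp_geB => //; apply: vp_geW rv; lia.
  have [] : exists z : int, fracpart p r / p%:R = z%:~R.
    apply: (@vp_ge0_int _ p_pr j.+1 c).
      by rewrite -(subrr 1%:Z); apply: vp_geM => //; exact: (vp_geX p_pr (-1)).
    by rewrite exprS mulrA divfK.
  move=> z az.
  have : c = z * (p ^ j.+1)%N.
    apply/eqP; rewrite -(eqr_int rat) -ac -(divfK p0 (fracpart p r)) az -mulrA.
    by rewrite -exprS intrM -natrX pmulrn.
  move=> cz; move: clt; rewrite cz abszM /= => clt.
  suff z0 : z = 0 by rewrite -(divfK p0 (fracpart p r)) az z0 mul0r.
  apply/eqP; rewrite -absz_eq0; apply: contraTT clt; rewrite -lt0n -leqNgt => z0.
  by rewrite -mulnA mulnCA leq_pmulr// muln_gt0 z0.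
Qed.

(** * Integrality and size of the successive beta_n *)

(* Holds from index 1 on; the initial state can fail it, e.g. when k_0 <= 0. *)
Definition running (p : nat) (s : bstate) : Prop :=
  exists (b b' x : int) (k : nat),
    [/\ bs_betap s = b%:~R, bs_beta s = b'%:~R, ~~ (p %| `|b'|)%N,
        bs_k s = k.+1 & bs_x s = x%:~R] /\
    vp_ge p k.+2%:Z (x%:~R - b%:~R / b'%:~R) /\ (`|x| * 2 < p ^ k.+2)%N.

(** Common to the initial step and the later ones, which obtain the divisibility of the numerator
    [m] in different ways. That divisibility makes the new exponent at least 1. *)
Lemma browkin_step_running (p : nat) (s s' : bstate) (b m : int) :
  prime p -> odd p -> bs_beta s = b%:~R ->
  bs_betap s - bs_x s * bs_beta s = m%:~R ->
  vp_ge p 1 (m%:~R / p%:R ^ bs_k s) -> browkin_step p s = Some s' ->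
  [/\ running p s', bs_betap s' = bs_beta s
    & bs_beta s' * (p%:R ^ bs_k s * p%:R ^ bs_k s') = m%:~R].
Proof.
move=> p_pr p_odd bE mE mge; rewrite /browkin_step mE bE !intr_eq0.
case: ifP => // /norP[b0 m0] [<-] /=.
have p0 : p%:R != 0 :> rat by rewrite pnatr_eq0 -lt0n prime_gt0.
have pZ0 k : p%:R ^ k != 0 :> rat by exact: expfz_neq0.
set k := vp p _.
(* The two exponents add up to the full power of [p] in [m], so the new beta is the signed
   prime-to-[p] part of [m]. *)
have kE : k = (logn p `|m|)%:Z - bs_k s.
  rewrite /k (@vp_fracX p p_pr _ m 1 (- bs_k s)) //=.
    by rewrite logn1; lia.
  by rewrite mulr1 invr_expz.
have k_gt0 : 1 <= k.
  case: mge => // /eqP; rewrite mulf_eq0 intr_eq0 (negbTE m0) invr_eq0.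
  by rewrite (negbTE (pZ0 _)).
have m_gt0 : (0 < `|m|)%N by rewrite absz_gt0.
have [c pc mc] := pfactor_coprime p_pr m_gt0.
have ppE : p%:R ^ bs_k s * p%:R ^ k = p%:R ^+ logn p `|m| :> rat.
  by rewrite -expfzDr// kE addrC subrK.
have cE : m%:~R / (p%:R ^ bs_k s * p%:R ^ k) = (Num.sg m * c%:Z)%:~R :> rat.
  apply: (canLR (mulfK _)); first by rewrite mulf_neq0.
  move: ppE mc; set e := logn p `|m| => ppE mc.
  by rewrite ppE {1}[m]numEsg -abszE mc PoszM !intrM -mulrA -!pmulrn natrX.
have ndvd : ~~ (p %| `|(Num.sg m * c%:Z)%R|)%N.
  by rewrite abszM absz_sg m0 mul1n /= -prime_coprime.
split => //; last by rewrite divfK ?mulf_neq0.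
have [k' k'E] : exists k' : nat, k = k'.+1 by exists `|k - 1|%N; lia.
have [xv xlt] := balanced_residueP k'.+1 p_pr p_odd (vp_ge_frac p_pr b ndvd).
exists b, (Num.sg m * c%:Z), (balanced_residue p k (b%:~R / (Num.sg m * c%:Z)%:~R)), k'.
by rewrite cE k'E.
Qed.

(** The congruence on [x] makes the numerator divisible by [p ^ k.+2], one power more than
    [p ^ bs_k s]. The size of [x] yields the coefficient 1/2, and both exponents being at least 1
    yields [1 / p ^ 2]. *)
Lemma running_step (p : nat) (s s' : bstate) : prime p -> odd p ->
  running p s -> browkin_step p s = Some s' ->
  [/\ running p s', bs_betap s' = bs_beta s
    & `|bs_beta s'| <= `|bs_beta s| / 2 + `|bs_betap s| / p%:R ^+ 2].
Proof.
move=> p_pr p_odd [b [b' [x [k [[bE b'E pb kE xE] [xv xlt]]]]]] ss'.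
have p_gt0 : 0 < p%:R :> rat by rewrite ltr0n prime_gt0.
have b'0 : b'%:~R != 0 :> rat.
  by rewrite intr_eq0; apply: contraNneq pb => ->; rewrite dvdn0.
have numE : bs_betap s - bs_x s * bs_beta s = (b - x * b')%:~R.
  by rewrite bE b'E xE intrB intrM.
have numv : vp_ge p 1 ((b - x * b')%:~R / p%:R ^ bs_k s).
  rewrite kE.
  have -> : (b - x * b')%:~R = - (b'%:~R * (x%:~R - b%:~R / b'%:~R)) :> rat.
    by rewrite intrB intrM; field; rewrite b'0.
  rewrite mulNr; apply: vp_geN => //.
  rewrite invr_expz (_ : 1 = 0 + k.+2%:Z + - k.+1%:Z); last by lia.
  apply: vp_geM => //; last exact: vp_geX.
  by apply: vp_geM => //; exact: vp_ge_int.
have [run' bp' bE'] := browkin_step_running p_pr p_odd b'E numE numv ss'.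
split => //.
case: run' => [c [c' [x' [k' [[_ c'E _ k'E _] _]]]]].
move: bE'; rewrite -numE kE k'E.
rewrite -[_ ^ _ * _]/(p%:R ^+ k.+1 * p%:R ^+ k'.+1) => bE'.
have P_gt0 : 0 < p%:R ^+ k.+1 * p%:R ^+ k'.+1 :> rat by rewrite mulr_gt0// exprn_gt0.
have p1 : 1 <= p%:R :> rat by rewrite ler1n prime_gt0.
have pk1 : 0 <= p%:R ^+ k - 1 :> rat by rewrite subr_ge0 exprn_ege1.
have pk1' : 0 <= p%:R ^+ k' - 1 :> rat by rewrite subr_ge0 exprn_ege1.
have xle : `|bs_x s| <= p%:R ^+ k.+2 / 2.
  rewrite xE ler_pdivlMr// -intr_norm -abszE -pmulrn.
  by rewrite -natrM -natrX ler_nat ltnW.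
rewrite -(ler_pM2r P_gt0) -{1}(gtr0_norm P_gt0) -normrM bE'.
apply: (le_trans (ler_normB _ _)); rewrite normrM addrC mulrDl.
move: xle pk1 pk1'; rewrite !exprS expr0 mulr1.
move: (p%:R ^+ k) (p%:R ^+ k') => A B xle A1 B1.
apply: lerD.
  rewrite mulrC -mulrA; apply: ler_wpM2l => //; apply: (le_trans xle).
  have : 0 <= p%:R * p%:R * A * (B - 1) by rewrite !mulr_ge0// ltW//; lra.
  lra.
rewrite -mulrA ler_peMr//.
have -> : (p%:R * p%:R)^-1 * (p%:R * A * (p%:R * B)) = A * B.
  by field; rewrite gt_eqF.
by apply: mulr_ege1; rewrite -subr_ge0.
Qed.

(** Here [x_0] is an integer by [scaled_fracpart_int], and the numerator over [p ^ k_0] equals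
    [beta * (r - fracpart p r)], of valuation at least 1. *)
Lemma browkin_init_step (p : nat) (r : rat) (alpha : int) (beta : nat) (s : bstate) :
  prime p -> odd p -> (0 < beta)%N ->
  r = alpha%:~R / (beta%:R * p%:R ^ (- vp p r)) ->
  browkin_step p (browkin_init p r alpha beta) = Some s ->
  running p s /\ bs_betap s = beta%:R.
Proof.
move=> p_pr p_odd beta_gt0 rE.
have p0 : p%:R != 0 :> rat by rewrite pnatr_eq0 -lt0n prime_gt0.
have [z x0E] := scaled_fracpart_int r p_pr p_odd.
have [ra _] := fracpartP r p_pr p_odd.
have numE : bs_betap (browkin_init p r alpha beta) -
    bs_x (browkin_init p r alpha beta) * bs_beta (browkin_init p r alpha beta)
    = (alpha - z * beta%:Z)%:~R.
  by rewrite /= x0E intrB intrM.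
have bE : bs_beta (browkin_init p r alpha beta) = beta%:Z%:~R by [].
move=> /(browkin_step_running p_pr p_odd bE numE)[]//.
rewrite -numE /=.
have -> : (alpha%:~R - p%:R ^ (- vp p r) * fracpart p r * beta%:R) / p%:R ^ (- vp p r)
    = beta%:~R * (r - fracpart p r).
  have b0 : beta%:R != 0 :> rat by rewrite pnatr_eq0 -lt0n.
  move: rE (expfz_neq0 (- vp p r) p0); rewrite -pmulrn.
  move: (_ ^ _) (fracpart p r) => P a -> P0.
  by field; rewrite P0 b0.
by rewrite -[1]add0r; apply: vp_geM => //; exact: vp_ge_int.
Qed.

(** * The roots and the dominating geometric sequence *)

Section Lambda.
Variables (R : realType) (p : nat).
Hypothesis p_gt2 : (2 < p)%N.
Local Notation L := (lambda1 R p).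
Local Notation M := (lambda2 R p).

Let P : R := p%:R.

Let P3 : 3 <= P.
Proof. by rewrite ler_nat. Qed.

Lemma lambda_factor (X : R) :
  2 * p%:R ^+ 2 * X ^+ 2 - p%:R ^+ 2 * X - 2 = 2 * p%:R ^+ 2 * ((X - L) * (X - M)).
Proof.
rewrite /lambda1 /lambda2 -/P.
have /sqr_sqrtr : 0 <= P ^+ 2 + 16 by have := P3; nra.
move: (Num.sqrt _) => s sE; have P0 : P != 0 by apply: lt0r_neq0; have := P3; lra.
have -> : 2 * P ^+ 2 * ((X - (P + s) / (4 * P)) * (X - (P - s) / (4 * P))) =
  2 * P ^+ 2 * X ^+ 2 - P ^+ 2 * X - (s ^+ 2 - P ^+ 2) / 8 by field; rewrite P0.
by rewrite sE; field.
Qed.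

Lemma lambda_roots (X : R) :
  2 * p%:R ^+ 2 * X ^+ 2 - p%:R ^+ 2 * X - 2 = 0 <-> X = L \/ X = M.
Proof.
have P2 : 2 * p%:R ^+ 2 != 0 :> R by apply: lt0r_neq0; have := P3; rewrite /P; nra.
rewrite lambda_factor; split => [/eqP|].
  by rewrite mulf_eq0 (negbTE P2) mulf_eq0 !subr_eq0 /= => /orP[]/eqP; [left|right].
by case=> ->; rewrite subrr ?mul0r ?mulr0.
Qed.

Lemma lambda1_sqr : L ^+ 2 = L / 2 + 1 / p%:R ^+ 2.
Proof.
have /lambda_roots := or_introl (erefl L) : L = L \/ L = M.
rewrite -/P => E; have P0 : P != 0 by apply: lt0r_neq0; have := P3; lra.
have P2 : 2 * P ^+ 2 != 0 by apply: lt0r_neq0; have := P3; nra.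
apply: (mulfI P2).
have -> : 2 * P ^+ 2 * (L / 2 + 1 / P ^+ 2) = P ^+ 2 * L + 2 by field; rewrite P0.
by move: E; lra.
Qed.

Lemma lambda1_bounds : 1 / 2 < L < 1.
Proof.
rewrite /lambda1 -/P; have := P3.
have /sqr_sqrtr : 0 <= P ^+ 2 + 16 by have := P3; nra.
have := sqrtr_ge0 (P ^+ 2 + 16).
move: (Num.sqrt _) => s s0 sE P3'.
(* The bounds amount to [p < s < 3 * p], where [s ^ 2 = p ^ 2 + 16]. *)
by apply/andP; split; [rewrite ltr_pdivlMr|rewrite ltr_pdivrMr]; nra.
Qed.

Lemma lambda_sub : L - M = 2 * L - 1 / 2.
Proof.
rewrite /lambda1 /lambda2 -/P; have P0 : P != 0 by apply: lt0r_neq0; have := P3; lra.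
by field; rewrite P0.
Qed.

Lemma lambda1_rec (n : nat) (C : R) :
  L ^+ n.+2 * C = L ^+ n.+1 * C / 2 + L ^+ n * C / p%:R ^+ 2.
Proof. by rewrite -[n.+2]addn2 exprD lambda1_sqr [L ^+ n.+1]exprS; ring. Qed.

(** With [c = b1 / (L - M)], so that [C = 2 * c + b0], the first inequality reduces to
    [2 * c * (L - 1/2) ^ 2 + L ^ 2 * b0 >= 0]. In the second, the coefficients of [c] and [b0] are
    separately nonnegative. *)
Lemma lambda1_init (b0 b1 : R) : 0 <= b0 -> 0 <= b1 ->
  let C := 2 * b1 / (L - M) + b0 in
  b1 <= L ^+ 2 * C /\ b1 / 2 + b0 / p%:R ^+ 2 <= L ^+ 3 * C.
Proof.
move=> b00 b10 /=; rewrite lambda_sub.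
have /andP[L1 L2] := lambda1_bounds.
have -> : b0 / p%:R ^+ 2 = b0 * (L ^+ 2 - L / 2).
  by rewrite lambda1_sqr addrAC subrr add0r mul1r.
have D0 : 0 < 2 * L - 1 / 2 by lra.
have E : b1 = (b1 / (2 * L - 1 / 2)) * (2 * L - 1 / 2).
  by rewrite divfK// lt0r_neq0.
have c0 : 0 <= b1 / (2 * L - 1 / 2) by rewrite divr_ge0// ltW.
rewrite -[2 * b1 / _]mulrA; move: c0 E.
move: L (b1 / _) L1 L2 {D0} => l c l1 l2 c0 ->.
have h : 0 <= c * (l - 1 / 2) ^+ 2 by rewrite mulr_ge0// sqr_ge0.
have h' : 0 <= l ^+ 2 * b0 by rewrite mulr_ge0// sqr_ge0.
split; first by lra.
have h1 : 0 <= c * (2 * l ^+ 3 - (2 * l - 1 / 2) / 2) by rewrite mulr_ge0//; nra.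
have h2 : 0 <= b0 * (l ^+ 3 - (l ^+ 2 - l / 2)) by rewrite mulr_ge0//; nra.
lra.
Qed.

Lemma le_floor_log (m : nat) (C : R) : 1 <= L ^+ m * C ->
  m%:Z <= Num.floor (-1 / ln L * ln C).
Proof.
move=> C1; have /andP[L1 L2] := lambda1_bounds.
have L0 : 0 < L by lra.
have Lm : 0 < L ^+ m by rewrite exprn_gt0.
have C0 : 0 < C by rewrite -(pmulr_rgt0 _ Lm); lra.
rewrite floor_ge_int.
have lnL : ln L < 0 by rewrite ln_lt0// L0.
have := ln_ge0 C1; rewrite lnM// lnXn// -mulr_natl => h.
rewrite mulrAC ler_ndivlMr// -pmulrn; lra.
Qed.

End Lambda.

(** * Counting the partial quotients *)

(** The last conjunct bounds the right-hand side of the recurrence rather than the previous beta: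
    this lets the induction start at index 1, although [beta_0] may exceed [lambda1 * C]. *)
Lemma browkin_bounds (R : realType) (p : nat) (r : rat) (alpha : int) (beta n : nat)
    (s : bstate) (b := fun i => ratr `|browkin_beta p r alpha beta i| : R)
    (C := 2 * b 1%N / (lambda1 R p - lambda2 R p) + b 0%N) :
  prime p -> odd p -> (0 < beta)%N ->
  r = alpha%:~R / (beta%:R * p%:R ^ (- vp p r)) ->
  browkin p r alpha beta n.+1 = Some s ->
  [/\ running p s, ratr `|bs_beta s| <= lambda1 R p ^+ n.+2 * C
    & ratr `|bs_beta s| / 2 + ratr `|bs_betap s| / p%:R ^+ 2
        <= lambda1 R p ^+ n.+3 * C].
Proof.
move=> p_pr p_odd beta_gt0 rE.
have p_gt2 := odd_prime_gt2 p_odd p_pr.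
have b_ge0 i : 0 <= b i by rewrite ler0q.
elim: n s => [|n IH] s.
  move=> s1; have [run bp] := browkin_init_step p_pr p_odd beta_gt0 rE s1.
  have b1 : b 1%N = ratr `|bs_beta s| by rewrite /b /browkin_beta s1.
  have b0 : b 0%N = ratr `|bs_betap s| by rewrite bp.
  by rewrite -b1 -b0; have [] := lambda1_init p_gt2 (b_ge0 0%N) (b_ge0 1%N).
rewrite /browkin iterS -/(browkin p r alpha beta n.+1).
case sn: (browkin _ _ _ _ _) => [t|//] /= ts.
have [run le1 le2] := IH t sn.
have [run' bp le3] := running_step p_pr p_odd run ts.
have le4 : ratr `|bs_beta s| <= lambda1 R p ^+ n.+3 * C.
  apply: le_trans le2; move: le3; rewrite -(ler_rat R) => /le_trans; apply.
  by rewrite rmorphD !rmorphM !fmorphV /= rmorphXn /= !ratr_nat.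
split => //; rewrite (lambda1_rec p_gt2) bp lerD//.
  by rewrite ler_pM2r.
by rewrite ler_pM2r// invr_gt0 exprn_gt0// ltr0n prime_gt0.
Qed.

Lemma browkin_defined_lt (R : realType) (p : nat) (r : rat) (alpha : int)
    (beta n : nat) (s : bstate) :
  prime p -> odd p -> (0 < beta)%N ->
  r = alpha%:~R / (beta%:R * p%:R ^ (- vp p r)) ->
  browkin p r alpha beta n.+1 = Some s ->
  n.+2%:Z <= Num.floor (browkin_bound R p r alpha beta).
Proof.
move=> p_pr p_odd beta_gt0 rE ns.
have p_gt2 := odd_prime_gt2 p_odd p_pr.
have [[_ [c [_ [_ [[_ sc pc _ _] _]]]]] le1 _] :=
  browkin_bounds R p_pr p_odd beta_gt0 rE ns.
apply: le_floor_log => //; rewrite -!ratr_norm.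
(* The beta at index [n.+1] is an integer prime to [p], hence of absolute value at least 1. *)
apply: le_trans le1; rewrite sc -intr_norm ratr_int ler1z -gtz0_ge1 normr_gt0.
by apply: contraNneq pc => ->; rewrite dvdn0.
Qed.

Lemma browkin_bound_ge1 (R : realType) (p : nat) (r : rat) (alpha : int) (beta : nat) :
  prime p -> odd p -> (0 < beta)%N ->
  r = alpha%:~R / (beta%:R * p%:R ^ (- vp p r)) ->
  ~ browkin_degenerate p r beta ->
  1 <= Num.floor (browkin_bound R p r alpha beta).
Proof.
move=> p_pr p_odd beta_gt0 rE ndeg.
have p_gt2 := odd_prime_gt2 p_odd p_pr.
case s1: (browkin p r alpha beta 1) => [s|].
  by apply: le_trans (browkin_defined_lt R p_pr p_odd beta_gt0 rE s1).
apply: (@le_floor_log R p p_gt2 1%N).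
(* The algorithm stopped after [a_0], so [beta_1] takes its default value 0 and the claim becomes
   [1 <= lambda1 * beta]. As [lambda1 > 1/2], [beta >= 2] suffices. *)
rewrite {1}/browkin_beta s1 rmorph0 normr0 mulr0 mul0r add0r expr1.
rewrite /browkin_beta /= ratr_nat normr_nat.
have /andP[L1 L2] := lambda1_bounds R p_gt2.
suff beta2 : (2 <= beta)%N.
  have : 2 <= beta%:R :> R by rewrite ler_nat.
  nra.
rewrite ltn_neqAle beta_gt0 andbT eq_sym; apply/eqP => beta1; apply: ndeg.
split => //; move: s1; rewrite /browkin /= /browkin_step /= beta1 /= mulr1.
(* With [beta = 1], stopping means [alpha = p ^ k_0 * fracpart p r], that is, [r = fracpart p r]:
   the degenerate case. *)
case: ifP => //= /eqP/subr0_eq aE _; rewrite {2}rE aE beta1 mul1r.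
by rewrite mulrC mulKf// expfz_neq0// pnatr_eq0 -lt0n prime_gt0.
Qed.

Unset Implicit Arguments.

Theorem theorem3p1 (R : realType) (p : nat) (hp : prime p) (hodd : odd p)
    (r : rat) (hr : r != 0) (alpha : int) (beta : nat) (hbeta : (0 < beta)%N)
    (halphap : coprime `|alpha|%N p) (hbetap : coprime beta p)
    (hrE : r = alpha%:~R / (beta%:R * p%:R ^ (- vp p r))) :
  [/\ finite_set (browkin_indices p r alpha beta),
      ~ browkin_degenerate p r beta ->
        (#|` fset_set (browkin_indices p r alpha beta)|)%:Z
          <= Num.floor (browkin_bound R p r alpha beta)
    & forall X : R, 2 * p%:R ^+ 2 * X ^+ 2 - p%:R ^+ 2 * X - 2 = 0 <->
        (X = lambda1 R p \/ X = lambda2 R p)].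
Proof.
have le_bound n s : browkin p r alpha beta n.+1 = Some s ->
    n.+2%:Z <= Num.floor (browkin_bound R p r alpha beta).
  exact: browkin_defined_lt.
set B := Num.floor _ in le_bound *.
split; last by move=> X; apply: lambda_roots; exact: odd_prime_gt2.
(* The successor leaves room for index 0, since [B] may be 0 in the degenerate case. *)
- apply: (@sub_finite_set _ _ `I_(`|B|.+1)); last exact: finite_II.
  by move=> [|n] [s [ns _ _]] //=; have := le_bound _ _ ns; lia.
- move=> ndeg.
  have B1 : 1 <= B by exact: browkin_bound_ge1.
  have sub : (browkin_indices p r alpha beta `<=` `I_(`|B|))%classic.
    move=> [|n] [s [ns _ _]] /=; first by lia.
    by have := le_bound _ _ ns; lia.
  rewrite -[B]gez0_abs ?lez_nat; last by lia.
  exact: geq_card_fset_set (subset_card_le sub).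
Qed.
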